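(* Suppose there exist $\kappa\ge 1$ and $\delta,\theta$ with $\delta<1$ and $\theta\le (1-\delta)/2$ such that $\|\kappa^{-1}\mathbf{H}_t^{(T)}-\mathbf{I}\|\le\delta$ for all $T\ge 0$, $0\le t\le T$, and $\|\mathbf{E}_t\|\le\kappa\theta$ for all $t\ge 0$. Let $$\epsilon_* = \frac{1+\delta}{2}-\sqrt{\frac{(1-\delta)^2}{4}-\theta^2},$$ and suppose that $\theta<1-\epsilon_*$. Suppose also that $$M_y=\sup_{t\ge 0}\left\|\begin{bmatrix}\mathbf{y}_t\\ \mathbf{y}_{t+1}\end{bmatrix}\right\|<\infty.$$ Then for every $t\ge 0$ there exists $\mathbf{x}_t^*\in\mathbb{R}^n$ such that $\hat{\mathbf{x}}_{t|T}\to\mathbf{x}_t^*$ as $T\to\infty$ ($T\ge t$), and there is a constant $C(\epsilon_*,\theta,\delta)$, depending only on $\epsilon_*,\theta,\delta$, such that $$\|\hat{\mathbf{x}}_{t|T}-\mathbf{x}_t^*\|\le C(\epsilon_*,\theta,\delta)\,M_y\left(\frac{\theta}{1-\epsilon_*}\right)^{T-t}\qquad\text{for all } t\le T.$$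
   Context: Streaming least squares. Data: matrices $\mathbf{A}_t\in\mathbb{R}^{m\times n}$ ($t\ge 0$), $\mathbf{B}_t\in\mathbb{R}^{m\times n}$ ($t\ge1$), vectors $\mathbf{y}_t\in\mathbb{R}^m$ ($t\ge 0$), and a regularization parameter $\gamma\ge 0$. For each $T\ge 0$, $(\hat{\mathbf{x}}_{0|T},\dots,\hat{\mathbf{x}}_{T|T})$, with blocks $\hat{\mathbf{x}}_{t|T}\in\mathbb{R}^n$, denotes the minimizer over $(\mathbf{x}_0,\dots,\mathbf{x}_T)$ of $$\|\mathbf{A}_0\mathbf{x}_0-\mathbf{y}_0\|^2+\gamma\|\mathbf{x}_0\|^2+\sum_{t=1}^T\left(\|\mathbf{B}_t\mathbf{x}_{t-1}+\mathbf{A}_t\mathbf{x}_t-\mathbf{y}_t\|^2+\gamma\|\mathbf{x}_t\|^2\right).$$ The normal equations form a block-tridiagonal system with diagonal blocks $\mathbf{H}_t^{(T)}=\mathbf{A}_t^\top\mathbf{A}_t+\mathbf{B}_{t+1}^\top\mathbf{B}_{t+1}+\gamma\mathbf{I}$ for $0\le t\le T-1$ and $\mathbf{H}_T^{(T)}=\mathbf{A}_T^\top\mathbf{A}_T+\gamma\mathbf{I}$, subdiagonal blocks $\mathbf{E}_t=\mathbf{A}_{t+1}^\top\mathbf{B}_{t+1}$ in block position $(t+1,t)$ and superdiagonal blocks $\mathbf{E}_t^\top$ in position $(t,t+1)$. $\|\cdot\|$ is the Euclidean norm for vectors and the induced operator norm for matrices. *)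

(* Defs.v *)
(* Library: MathComp + MathComp-Analysis. *)
From mathcomp Require Import all_boot all_order all_algebra.
From mathcomp Require Import all_classical all_reals all_analysis.

Set Implicit Arguments.
Unset Strict Implicit.
Unset Printing Implicit Defensive.

Import Order.TTheory GRing.Theory Num.Theory.
Import numFieldNormedType.Exports.

Local Open Scope classical_set_scope.
Local Open Scope ring_scope.

(* The library norm `|_| on matrices is the max norm, hence the two norms
   below. *)
Definition l2norm (R : realType) (n : nat) (v : 'cV[R]_n) : R :=
  Num.sqrt (\sum_i v i 0 ^+ 2).

(* The supremum is over the closed unit ball rather than the unit sphere, so
   that the set is nonempty (and the norm 0) also when n = 0. *)
Definition opnorm (R : realType) (m n : nat) (M : 'M[R]_(m, n)) : R :=
  sup [set l2norm (M *m v) | v in [set v : 'cV[R]_n | l2norm v <= 1]].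

Section StreamingLeastSquares.
Variables (R : realType) (m n : nat).
Variables (A B : nat -> 'M[R]_(m, n)) (y : nat -> 'cV[R]_m) (gamma : R).

(* Only B_1, B_2, ... are data: the value B 0 is never used. The blocks
   (x_0, ..., x_T) are the first T + 1 entries of a sequence x; the cost for
   horizon T does not depend on the other entries. *)
Definition lsq_cost (T : nat) (x : nat -> 'cV[R]_n) : R :=
  l2norm (A 0%N *m x 0%N - y 0%N) ^+ 2 + gamma * l2norm (x 0%N) ^+ 2
  + \sum_(1 <= t < T.+1)
      (l2norm (B t *m x t.-1 + A t *m x t - y t) ^+ 2
       + gamma * l2norm (x t) ^+ 2).

Definition lsq_minimizer (T : nat) (x : nat -> 'cV[R]_n) : Prop :=
  forall z : nat -> 'cV[R]_n, lsq_cost T x <= lsq_cost T z.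

(* Diagonal block t <= T of the normal equations for horizon T. *)
Definition Hblock (T t : nat) : 'M[R]_n :=
  (A t)^T *m A t
  + (if (t < T)%N then (B t.+1)^T *m B t.+1 else 0)
  + gamma *: 1%:M.

(* Subdiagonal block, in block position (t + 1, t). *)
Definition Eblock (t : nat) : 'M[R]_n := (A t.+1)^T *m B t.+1.

Definition y_pair_norms : set R :=
  range (fun t : nat => l2norm (col_mx (y t) (y t.+1))).

End StreamingLeastSquares.

Definition eps_star (R : realType) (delta theta : R) : R :=
  (1 + delta) / 2 - Num.sqrt ((1 - delta) ^+ 2 / 4 - theta ^+ 2).

(* Main.v *)
(* Let u_t be the difference of the minimizers for two horizons S >= T. The
   normal equations in rows t < T are the same for both, so u solves the
   homogeneous block-tridiagonal recursion there, and ||H_t v|| >= kappa (1 -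
   delta) ||v|| gives
     (1 - delta) ||u_t|| <= theta ||u_(t-1)|| + theta ||u_(t+1)||.
   With s = 1 - eps_star, the larger root of s^2 = (1 - delta) s - theta^2,
   induction on t yields s ||u_t|| <= theta ||u_(t+1)||, hence
   ||u_t|| <= (theta / s)^(T - t) ||u_T||. The minimizers themselves are bounded
   by sqrt (1 + delta) M_y / (1 - delta - 2 theta), by looking at a row where
   the norm of the block is maximal. So the minimizers form a Cauchy sequence
   with the required rate. *)
Require Import Defs.
From mathcomp Require Import all_boot all_order all_algebra.
From mathcomp Require Import all_classical all_reals all_analysis.
From mathcomp Require Import ring lra.

Set Implicit Arguments.
Unset Strict Implicit.
Unset Printing Implicit Defensive.

Import Order.TTheory GRing.Theory Num.Theory.
Import numFieldNormedType.Exports.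

Local Open Scope classical_set_scope.
Local Open Scope ring_scope.

(** * Euclidean inner product, Euclidean norm and operator norm *)

Section EuclideanNorm.
Context {R : realType}.

Definition dotv n (u v : 'cV[R]_n) : R := (u^T *m v) 0 0.

Lemma dotvE n (u v : 'cV[R]_n) : dotv u v = \sum_i u i 0 * v i 0.
Proof. by rewrite /dotv mxE; apply: eq_bigr => i _; rewrite mxE. Qed.

Lemma dotvC n (u v : 'cV[R]_n) : dotv u v = dotv v u.
Proof. by rewrite !dotvE; apply: eq_bigr => i _; rewrite mulrC. Qed.

Lemma dotvDr n (u v w : 'cV[R]_n) : dotv u (v + w) = dotv u v + dotv u w.
Proof. by rewrite /dotv mulmxDr mxE. Qed.

Lemma dotvDl n (u v w : 'cV[R]_n) : dotv (v + w) u = dotv v u + dotv w u.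
Proof. by rewrite dotvC dotvDr !(dotvC u). Qed.

Lemma dotvZr n a (u v : 'cV[R]_n) : dotv u (a *: v) = a * dotv u v.
Proof. by rewrite /dotv -scalemxAr mxE. Qed.

Lemma dotvZl n a (u v : 'cV[R]_n) : dotv (a *: u) v = a * dotv u v.
Proof. by rewrite dotvC dotvZr dotvC. Qed.

Lemma dotv0r n (u : 'cV[R]_n) : dotv u 0 = 0.
Proof. by rewrite /dotv mulmx0 mxE. Qed.

Lemma dotv_mulmxr m n (M : 'M[R]_(m, n)) u v :
  dotv u (M *m v) = dotv (M^T *m u) v.
Proof. by rewrite /dotv trmx_mul trmxK mulmxA. Qed.

Lemma dotv_ge0 n (v : 'cV[R]_n) : 0 <= dotv v v.
Proof. by rewrite dotvE sumr_ge0// => i _; rewrite -expr2 sqr_ge0. Qed.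

Lemma l2normE n (v : 'cV[R]_n) : l2norm v = Num.sqrt (dotv v v).
Proof. by rewrite dotvE. Qed.

Lemma sqr_l2norm n (v : 'cV[R]_n) : l2norm v ^+ 2 = dotv v v.
Proof. by rewrite l2normE sqr_sqrtr ?dotv_ge0. Qed.

Lemma l2norm_ge0 n (v : 'cV[R]_n) : 0 <= l2norm v.
Proof. exact: sqrtr_ge0. Qed.

Lemma l2norm0 n : l2norm (0 : 'cV[R]_n) = 0.
Proof. by rewrite l2normE dotv0r sqrtr0. Qed.

Lemma l2normZ n a (v : 'cV[R]_n) : l2norm (a *: v) = `|a| * l2norm v.
Proof.
by rewrite !l2normE dotvZl dotvZr mulrA -expr2 sqrtrM ?sqr_ge0// sqrtr_sqr.
Qed.

Lemma l2normN n (v : 'cV[R]_n) : l2norm (- v) = l2norm v.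
Proof. by rewrite -scaleN1r l2normZ normrN1 mul1r. Qed.

Lemma l2norm_eq0 n (v : 'cV[R]_n) : l2norm v = 0 -> v = 0.
Proof.
move=> v0; apply/colP => i; rewrite mxE; apply/eqP; rewrite -sqrf_eq0.
have : l2norm v ^+ 2 = 0 by rewrite v0 expr0n.
rewrite sqr_l2norm dotvE => /eqP; rewrite psumr_eq0; last first.
  by move=> j _; rewrite -expr2 sqr_ge0.
by move=> /allP/(_ i); rewrite mem_index_enum -expr2 => /(_ isT).
Qed.

(** Cauchy-Schwarz: expand the squared norm of [l2norm v *: u - l2norm u *: v]. The zero cases come
    first because the result is divided by [l2norm u * l2norm v]. *)
Lemma dotv_le n (u v : 'cV[R]_n) : dotv u v <= l2norm u * l2norm v.
Proof.
have [u0|u0] := eqVneq (l2norm u) 0.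
  by rewrite (l2norm_eq0 u0) dotvC dotv0r l2norm0 mul0r.
have [v0|v0] := eqVneq (l2norm v) 0.
  by rewrite (l2norm_eq0 v0) dotv0r l2norm0 mulr0.
have up : 0 < l2norm u by rewrite lt_def u0 l2norm_ge0.
have vp : 0 < l2norm v by rewrite lt_def v0 l2norm_ge0.
have := dotv_ge0 (l2norm v *: u + (- l2norm u) *: v).
rewrite !(dotvDl, dotvDr, dotvZl, dotvZr) (dotvC v u) -!sqr_l2norm.
set a := l2norm u in up *; set b := l2norm v in vp *; set d := dotv u v.
move=> h; rewrite -(ler_pM2l (mulr_gt0 up vp)).
lra.
Qed.

Lemma l2normD n (u v : 'cV[R]_n) : l2norm (u + v) <= l2norm u + l2norm v.
Proof.
rewrite -(@ler_pXn2r _ 2)// ?nnegrE ?addr_ge0 ?l2norm_ge0//.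
rewrite sqr_l2norm !(dotvDl, dotvDr) (dotvC v u) sqrrD -!sqr_l2norm.
by have := dotv_le u v; lra.
Qed.

Lemma l2normB n (u v : 'cV[R]_n) : l2norm (u - v) <= l2norm u + l2norm v.
Proof. by rewrite -(l2normN v) l2normD. Qed.

Lemma l2norm_coord n (v : 'cV[R]_n) i : `|v i 0| <= l2norm v.
Proof.
rewrite -(@ler_pXn2r _ 2)// ?nnegrE ?l2norm_ge0// real_normK ?num_real//.
rewrite sqr_l2norm dotvE (bigD1 i)//= expr2 lerDl sumr_ge0// => j _.
by rewrite -expr2 sqr_ge0.
Qed.

(** The crude factor [n] suffices for boundedness and for limits. A negative [e] forces [n = 0]. *)
Lemma l2norm_le_coord n (v : 'cV[R]_n) (e : R) :
  (forall i, `|v i 0| <= e) -> l2norm v <= n%:R * e.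
Proof.
move=> ve; have [i0|e0] := leP 0 e; last first.
  have v0 : v = 0.
    by apply/colP => i; have := le_lt_trans (ve i) e0; rewrite normr_lt0.
  case: n v ve v0 => [|n] v ve v0; first by rewrite v0 l2norm0 mul0r.
  by have := le_lt_trans (ve ord0) e0; rewrite normr_lt0.
rewrite -(@ler_pXn2r _ 2)// ?nnegrE ?l2norm_ge0 ?mulr_ge0// sqr_l2norm dotvE.
apply: (@le_trans _ _ (\sum_(i < n) e ^+ 2)).
  apply: ler_sum => i _; rewrite -expr2 -real_normK ?num_real//.
  by rewrite ler_pXn2r ?nnegrE.
rewrite sumr_const card_ord -[X in X <= _]mulr_natl exprMn ler_wpM2r ?sqr_ge0//.
by rewrite -natrX ler_nat; case: n {v ve} => // n; rewrite expnS leq_pmulr.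
Qed.

Lemma opnorm_has_sup m n (M : 'M[R]_(m, n)) :
  has_sup [set l2norm (M *m v) | v in [set v : 'cV[R]_n | l2norm v <= 1]].
Proof.
split; first by exists (l2norm (M *m 0)), 0 => //=; rewrite l2norm0.
exists (m%:R * (\sum_i \sum_j `|M i j|)) => _ [v /= v1 <-].
apply: l2norm_le_coord => i; rewrite mxE.
apply: le_trans (ler_norm_sum _ _ _) _.
rewrite (bigD1 i)//= ler_wpDr ?sumr_ge0// => [j _|]; first by rewrite sumr_ge0.
apply: ler_sum => j _; rewrite normrM ler_piMr//.
exact: le_trans (l2norm_coord _ _) v1.
Qed.

Lemma opnormP m n (M : 'M[R]_(m, n)) v : l2norm (M *m v) <= opnorm M * l2norm v.
Proof.
have [v0|v0] := eqVneq (l2norm v) 0.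
  by rewrite (l2norm_eq0 v0) mulmx0 !l2norm0 mulr0.
have vp : 0 < l2norm v by rewrite lt_def v0 l2norm_ge0.
have -> : M *m v = l2norm v *: (M *m ((l2norm v)^-1 *: v)).
  by rewrite -scalemxAr scalerA divff// scale1r.
rewrite l2normZ ger0_norm ?l2norm_ge0// mulrC ler_pM2r//.
apply: ub_le_sup; first by case: (opnorm_has_sup M).
exists ((l2norm v)^-1 *: v) => //=.
by rewrite l2normZ ger0_norm ?invr_ge0 ?l2norm_ge0// mulVf.
Qed.

Lemma opnorm_ge0 m n (M : 'M[R]_(m, n)) : 0 <= opnorm M.
Proof.
apply: (@le_trans _ _ (l2norm (M *m 0))); first exact: l2norm_ge0.
apply: ub_le_sup; first by case: (opnorm_has_sup M).
by exists 0 => //=; rewrite l2norm0.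
Qed.

(** Duality: the square of the left side is the inner product of [v] with [M *m (M^T *m v)]; apply
    Cauchy-Schwarz and [opnormP], then divide by the norm of [M^T *m v]. *)
Lemma opnorm_trP m n (M : 'M[R]_(m, n)) v :
  l2norm (M^T *m v) <= opnorm M * l2norm v.
Proof.
have [w0|w0] := eqVneq (l2norm (M^T *m v)) 0.
  by rewrite w0 mulr_ge0 ?opnorm_ge0 ?l2norm_ge0.
have wp : 0 < l2norm (M^T *m v) by rewrite lt_def w0 l2norm_ge0.
rewrite -(ler_pM2r wp) -expr2 sqr_l2norm -dotv_mulmxr.
apply: le_trans (dotv_le _ _) _.
by rewrite mulrC [leRHS]mulrAC ler_wpM2r ?l2norm_ge0// opnormP.
Qed.

End EuclideanNorm.

(** * First-order optimality and the normal equations *)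

Lemma quadratic_ge0_linear_eq0 (R : realType) (a b : R) :
  (forall c, 0 <= 2 * c * b + c ^+ 2 * a) -> b = 0.
Proof.
move=> h; have k0 : 0 < `|a| + 1 by rewrite ltr_wpDl.
(* A surrogate for the critical point [- b / a], with a denominator that is positive for every
   [a]. *)
have := h (- (b / (`|a| + 1))).
have -> : 2 * - (b / (`|a| + 1)) * b + (- (b / (`|a| + 1))) ^+ 2 * a
          = - (b / (`|a| + 1)) ^+ 2 * (2 * (`|a| + 1) - a).
  by field; rewrite gt_eqF.
have ka : 0 < 2 * (`|a| + 1) - a.
  by have := ler_norm a; have := normr_ge0 a; lra.
rewrite mulNr oppr_ge0 pmulr_lle0// => sq0.
have : (b / (`|a| + 1)) ^+ 2 == 0 by rewrite eq_le sq0 sqr_ge0.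
by rewrite sqrf_eq0 mulf_eq0 invr_eq0 (gt_eqF k0) orbF => /eqP.
Qed.

(* The convention x_(-1) = 0 removes the special case t = 0. *)
Definition pred_term (V : nmodType) (x : nat -> V) (t : nat) : V :=
  if t is t'.+1 then x t' else 0.

Section NormalEquations.
Variables (R : realType) (m n : nat).
Variables (A B : nat -> 'M[R]_(m, n)) (y : nat -> 'cV[R]_m) (gamma : R).
Implicit Types (x d : nat -> 'cV[R]_n) (T t : nat).

Definition lsq_model x t : 'cV[R]_m := B t *m pred_term x t + A t *m x t.

Lemma lsq_costE T x :
  lsq_cost A B y gamma T x =
  \sum_(t < T.+1)
    (l2norm (lsq_model x t - y t) ^+ 2 + gamma * l2norm (x t) ^+ 2).
Proof.
rewrite /lsq_cost big_ord_recl big_add1 big_mkord /lsq_model/= mulmx0 add0r.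
by congr (_ + _).
Qed.

Lemma lsq_modelD c x d t :
  lsq_model (fun s => x s + c *: d s) t = lsq_model x t + c *: lsq_model d t.
Proof.
rewrite /lsq_model; case: t => [|t] /=.
  by rewrite !mulmx0 !add0r mulmxDr scalemxAr.
by rewrite !mulmxDr -!scalemxAr scalerDr addrACA.
Qed.

(** Half the gradient of the cost in block [t], which enters residual [t] and, below the horizon,
    residual [t + 1]. *)
Definition lsq_grad T x t : 'cV[R]_n :=
  (A t)^T *m (lsq_model x t - y t) + gamma *: x t
  + (if (t < T)%N then (B t.+1)^T *m (lsq_model x t.+1 - y t.+1) else 0).

(** Summation by parts: moving [B] to the other side of the inner product turns the [d (t - 1)] term
    of row [t] into a term of gradient block [t - 1]. *)
Lemma dotv_lsq_grad T x d :
  \sum_(t < T.+1) (dotv (lsq_model x t - y t) (lsq_model d t)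
                   + gamma * dotv (x t) (d t))
  = \sum_(t < T.+1) dotv (lsq_grad T x t) (d t).
Proof.
under eq_bigr => t _ do rewrite dotvDr -addrA.
under [RHS]eq_bigr => t _ do rewrite !dotvDl dotvZl addrC.
rewrite !big_split/=; congr (_ + (_ + _)); last first.
  by apply: eq_bigr => t _; rewrite dotv_mulmxr.
(* Row 0 has no predecessor and block [T] no successor, so after dropping these zero terms both sums
   have [T] matching terms. *)
rewrite big_ord_recl/= mulmx0 dotv0r add0r [RHS]big_ord_recr/= ltnn.
rewrite dotvC dotv0r addr0; apply: eq_bigr => t _.
by rewrite ltn_ord dotv_mulmxr.
Qed.

(** The cost is quadratic, so its second-order expansion along a line is exact. *)
Lemma lsq_cost_line T x d c :
  lsq_cost A B y gamma T (fun t => x t + c *: d t) =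
  lsq_cost A B y gamma T x
  + (2 * c * (\sum_(t < T.+1) dotv (lsq_grad T x t) (d t))
  + c ^+ 2 * \sum_(t < T.+1)
      (l2norm (lsq_model d t) ^+ 2 + gamma * l2norm (d t) ^+ 2)).
Proof.
rewrite !lsq_costE -dotv_lsq_grad !mulr_sumr -!big_split/=.
apply: eq_bigr => t _; rewrite lsq_modelD addrAC !sqr_l2norm.
move: (lsq_model x t - y t) (lsq_model d t) => r v.
rewrite !(dotvDl, dotvDr, dotvZl, dotvZr) (dotvC (d t) (x t)) (dotvC v r).
ring.
Qed.

Lemma lsq_minimizer_grad T x t :
  lsq_minimizer A B y gamma T x -> (t <= T)%N -> lsq_grad T x t = 0.
Proof.
move=> xmin tT; set g := lsq_grad T x.
have : \sum_(s < T.+1) dotv (g s) (g s) = 0.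
  (* Perturb in the direction of the gradient itself: the linear coefficient is then its squared
     norm. *)
  apply: (@quadratic_ge0_linear_eq0 _ (\sum_(s < T.+1)
    (l2norm (lsq_model g s) ^+ 2 + gamma * l2norm (g s) ^+ 2))) => c.
  by have := xmin (fun s => x s + c *: g s); rewrite lsq_cost_line lerDl.
move=> /eqP; rewrite psumr_eq0 => [|i _]; last exact: dotv_ge0.
move=> /allP/(_ (Ordinal (tT : (t < T.+1)%N))); rewrite mem_index_enum.
by move=> /(_ isT)/=/eqP gt; apply: l2norm_eq0; rewrite l2normE gt sqrtr0.
Qed.

(* Block column t of the design matrix for horizon T, restricted to block rows
   t and t + 1; block row t + 1 is absent, here 0, when t = T. *)
Definition design_col T t : 'M[R]_(m + m, n) :=
  col_mx (A t) (if (t < T)%N then B t.+1 else 0).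

(** This Gram form lets the bound on the diagonal block control the adjoint of [design_col], and
    hence the right-hand side of the normal equations. *)
Lemma Hblock_design T t :
  Hblock A B gamma T t
  = (design_col T t)^T *m design_col T t + gamma *: 1%:M.
Proof.
rewrite /Hblock /design_col tr_col_mx mul_row_col.
by case: ifP => // _; rewrite mulmx0.
Qed.

(** Gradient block [t] set to zero and solved for the diagonal term. When [t = T], the entry
    [y t.+1] meets the zero block of [design_col]. *)
Lemma lsq_normal_equations T x t :
  lsq_minimizer A B y gamma T x -> (t <= T)%N ->
  Hblock A B gamma T t *m x t
  = (design_col T t)^T *m col_mx (y t) (y t.+1)
    - (A t)^T *m (B t *m pred_term x t)
    - (if (t < T)%N then (Eblock A B t)^T *m x t.+1 else 0).
Proof.
move=> /lsq_minimizer_grad/[apply]; rewrite /lsq_grad Hblock_design /design_col.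
rewrite tr_col_mx !mul_row_col /lsq_model /Eblock trmx_mul trmxK.
rewrite !mulmxDl -scalemxAl mul1mx !(mulmxDr, mulmxN) !mulmxA /=.
move: (_ *m x t) (_ *m y t) (_ *m pred_term x t) (gamma *: x t) => a b c d.
case: ifP => _; last first.
  rewrite trmx0 !mul0mx => /colP h; apply/colP => i.
  by move: (h i); rewrite !mxE; lra.
move: (_ *m x t) (_ *m y t.+1) (_ *m x t.+1) => e f g.
move=> /colP h; apply/colP => i; move: (h i); rewrite !mxE; lra.
Qed.

End NormalEquations.

(** * Consequences of a matrix being close to a multiple of the identity *)

Section NormEstimates.
Variables (R : realType) (n : nat) (H : 'M[R]_n) (kappa delta : R).
Hypotheses (kappa_gt0 : 0 < kappa)
           (HI : opnorm (kappa^-1 *: H - 1%:M) <= delta).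

Let scaled_residual v : l2norm (kappa^-1 *: (H *m v) - v) <= delta * l2norm v.
Proof.
have -> : kappa^-1 *: (H *m v) - v = (kappa^-1 *: H - 1%:M) *m v.
  by rewrite mulmxBl mul1mx scalemxAl.
exact: le_trans (opnormP _ _) (ler_wpM2r (l2norm_ge0 _) HI).
Qed.

Lemma near_id_lower v : kappa * ((1 - delta) * l2norm v) <= l2norm (H *m v).
Proof.
have := scaled_residual v; set w := kappa^-1 *: _ => wv.
have -> : H *m v = kappa *: w by rewrite scalerA divff ?scale1r ?gt_eqF.
rewrite l2normZ gtr0_norm// ler_pM2l//.
by have := l2normB w (w - v); rewrite opprB addrC subrK; lra.
Qed.

Lemma near_id_upper v : l2norm (H *m v) <= kappa * ((1 + delta) * l2norm v).
Proof.
have := scaled_residual v; set w := kappa^-1 *: _ => wv.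
have -> : H *m v = kappa *: w by rewrite scalerA divff ?scale1r ?gt_eqF.
rewrite l2normZ gtr0_norm// ler_pM2l//.
by have := l2normD (w - v) v; rewrite subrK; lra.
Qed.

(** Since [gamma] is nonnegative, the squared norm of [W *m g] is at most the inner product of [g]
    with [H *m g], so [near_id_upper] bounds [W]; duality carries the bound over to [W^T]. *)
Lemma gram_adjoint_bound m (W : 'M[R]_(m, n)) (gamma : R) (w : 'cV[R]_m) :
  0 <= gamma -> H = W^T *m W + gamma *: 1%:M ->
  l2norm (W^T *m w) <= Num.sqrt (kappa * (1 + delta)) * l2norm w.
Proof.
move=> gamma0 HE; set g := W^T *m w.
have c0 : 0 <= kappa * (1 + delta).
  rewrite mulr_ge0 ?(ltW kappa_gt0)// addr_ge0//.
  exact: le_trans (opnorm_ge0 _) HI.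
have Wg : l2norm (W *m g) <= Num.sqrt (kappa * (1 + delta)) * l2norm g.
  rewrite -(@ler_pXn2r _ 2)// ?nnegrE ?mulr_ge0 ?l2norm_ge0 ?sqrtr_ge0//.
  rewrite exprMn (sqr_sqrtr c0) sqr_l2norm dotv_mulmxr dotvC.
  apply: (@le_trans _ _ (dotv g (H *m g))).
    rewrite HE mulmxDl dotvDr mulmxA -scalemxAl mul1mx dotvZr lerDl.
    by rewrite mulr_ge0 ?dotv_ge0.
  apply: le_trans (dotv_le _ _) _; rewrite expr2 mulrCA.
  by rewrite ler_wpM2l ?l2norm_ge0// -mulrA near_id_upper.
have [g0|g0] := eqVneq (l2norm g) 0.
  by rewrite g0 mulr_ge0 ?sqrtr_ge0 ?l2norm_ge0.
have gp : 0 < l2norm g by rewrite lt_def g0 l2norm_ge0.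
rewrite -(ler_pM2r gp) -expr2 sqr_l2norm {2}/g dotv_mulmxr trmxK.
apply: le_trans (dotv_le _ _) _.
by rewrite [leRHS]mulrAC ler_wpM2r ?l2norm_ge0.
Qed.

End NormEstimates.

(** * Scalar tridiagonal inequalities: decay and boundedness *)

Section ScalarRecursions.
Context {R : realType}.

(** Multiply row [t + 1] by [s] and write [s * p] as [s ^+ 2 + theta ^+ 2]. By induction the term in
    [a t] is at most [theta ^+ 2 * a t.+1], which cancels; then divide by [s]. *)
Lemma tridiagonal_decay_step (a : nat -> R) (p s theta : R) T :
  0 < s -> 0 <= theta -> s ^+ 2 = p * s - theta ^+ 2 ->
  (forall t, 0 <= a t) ->
  (forall t, (t < T)%N -> p * a t <= theta * pred_term a t + theta * a t.+1) ->
  forall t, (t < T)%N -> s * a t <= theta * a t.+1.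
Proof.
move=> s0 theta0 sE a0 row; elim=> [|t IH] tT.
  (* The quadratic equation gives [s ^+ 2 <= p * s], hence [s <= p], and row 0 has no predecessor
     term. *)
  apply: le_trans (_ : _ <= p * a 0%N) _; last first.
    by have := row _ tT; rewrite /= mulr0 add0r.
  rewrite ler_wpM2r// -(ler_pM2r s0).
  by have := sqr_ge0 theta; rewrite -expr2; lra.
have h := ler_wpM2l (ltW s0) (row _ tT).
have ih := ler_wpM2l theta0 (IH (ltnW tT)).
have ps : p * s = s ^+ 2 + theta ^+ 2 by rewrite sE subrK.
have pE : s * (p * a t.+1) = s * (s * a t.+1) + theta * (theta * a t.+1).
  by rewrite mulrA [s * p]mulrC ps; ring.
by rewrite pE /= in h; rewrite -(ler_pM2l s0); lra.
Qed.

Lemma tridiagonal_decay (a : nat -> R) (p s theta : R) T :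
  0 < s -> 0 <= theta -> s ^+ 2 = p * s - theta ^+ 2 ->
  (forall t, 0 <= a t) ->
  (forall t, (t < T)%N -> p * a t <= theta * pred_term a t + theta * a t.+1) ->
  forall t, (t <= T)%N -> a t <= (theta / s) ^+ (T - t) * a T.
Proof.
move=> s0 theta0 sE a0 row t tT.
have step := tridiagonal_decay_step s0 theta0 sE a0 row.
(* The one-step bound passes from [t + 1] down to [t], so the induction is on the distance [k] to
   the horizon. *)
suff H k : (k <= T)%N -> a (T - k)%N <= (theta / s) ^+ k * a T.
  by rewrite -[in a t](subKn tT) H ?leq_subr.
elim: k => [|k IH] kT; first by rewrite subn0 mul1r.
have := step (T - k.+1)%N; rewrite ltn_subrL/= (leq_trans _ kT)//.
rewrite -subSn// subSS.
move=> /(_ isT) h; rewrite exprS -mulrA.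
apply: le_trans (ler_wpM2l _ (IH (ltnW kT))); last by rewrite divr_ge0// ltW.
by rewrite mulrAC ler_pdivlMr// mulrC.
Qed.

(** Maximum principle: at an index [k] where [a] is largest, each neighbour term is at most
    [theta * a k], leaving [(p - 2 * theta) * a k <= G]. *)
Lemma tridiagonal_bound (a : nat -> R) (p theta G : R) T :
  0 <= theta -> 2 * theta < p -> 0 <= G -> (forall t, 0 <= a t) ->
  (forall t, (t <= T)%N -> p * a t <= theta * pred_term a t
     + theta * (if (t < T)%N then a t.+1 else 0) + G) ->
  forall t, (t <= T)%N -> a t <= G / (p - 2 * theta).
Proof.
move=> theta0 thetap G0 a0 row t tT.
have [k _ kmax] := @arg_maxP _ _ _ (ord0 : 'I_T.+1) xpredT (fun i => a i) isT.
have {}kmax s : (s <= T)%N -> a s <= a k.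
  by move=> sT; exact: (kmax (Ordinal (sT : (s < T.+1)%N)) isT).
apply: le_trans (kmax _ tT) _.
have kT : (k <= T)%N by rewrite -ltnS.
rewrite ler_pdivlMr ?subr_gt0//.
have h1 : theta * pred_term a k <= theta * a k.
  rewrite ler_wpM2l//; case: (nat_of_ord k) kT (a0 k) (kmax) => //= k' k'T _.
  apply.
  exact: ltnW.
have h2 : theta * (if (k < T)%N then a k.+1 else 0) <= theta * a k.
  by rewrite ler_wpM2l//; case: ifP => // /kmax.
by have := row k kT; lra.
Qed.

End ScalarRecursions.

(** Convergence refers to the max norm and the rate to the Euclidean norm; the coordinate bounds
    translate between them. The rate passes to the limit by inserting a late [f S] between [f T] and
    [l]. *)
Lemma l2norm_cauchy_limit (R : realType) n (f : nat -> 'cV[R]_n)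
    (e : nat -> R) T0 :
  e @ \oo --> 0 ->
  (forall T S, (T0 <= T)%N -> (T <= S)%N -> l2norm (f S - f T) <= e T) ->
  exists l : 'cV[R]_n, f @ \oo --> l /\
    forall T, (T0 <= T)%N -> l2norm (f T - l) <= e T.
Proof.
move=> e0 fe; have fc : cvg (f @ \oo).
  apply/cauchy_cvgP/cauchy_exP => eps eps0.
  move/cvgrPdist_lt: (e0) => /(_ _ eps0)[N _ eN].
  exists (f (maxn N T0)); exists (maxn N T0) => // S /= NS; split=> // i j.
  rewrite (ord1 j) /ball/= -normrN opprB.
  have := l2norm_coord (f S - f (maxn N T0)) i; rewrite !mxE => h.
  apply: le_lt_trans h _; apply: le_lt_trans (fe _ _ (leq_maxr _ _) NS) _.
  have := eN _ (leq_maxl N T0); rewrite /= sub0r normrN; apply: le_lt_trans.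
  exact: ler_norm.
exists (lim (f @ \oo)); split=> // T T0T.
apply/ler_addgt0Pr => eps eps0.
(* Dividing by [n + 1] absorbs the factor [n] of [l2norm_le_coord] and stays meaningful for
   [n = 0]. *)
have eps'0 : 0 < eps / n.+1%:R by rewrite divr_gt0.
move/cvg_ballP: (fc) => /(_ _ eps'0)[N _ fN].
pose S := maxn N T; have [_ fl] := fN S (leq_maxl _ _).
rewrite -(subrKA (f S)); apply: le_trans (l2normD _ _) _; apply: lerD.
  by rewrite -l2normN opprB; apply: fe (leq_maxr _ _).
apply: le_trans (l2norm_le_coord (e := eps / n.+1%:R) _) _.
  by move=> i; have := fl i 0; rewrite /ball/= !mxE -normrN opprB => /ltW.
rewrite mulrCA ler_piMr ?(ltW eps0)// ler_pdivrMr// mul1r ler_nat.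
exact: leqnSn.
Qed.

(** * Row estimates for the minimizers and for their differences *)

Section LeastSquaresEstimates.
Variables (R : realType) (m n : nat).
Variables (A B : nat -> 'M[R]_(m, n)) (y : nat -> 'cV[R]_m).
Variables (gamma kappa delta theta : R).
Hypotheses (gamma_ge0 : 0 <= gamma) (kappa_ge1 : 1 <= kappa).
Hypothesis Hblock_near : forall T t : nat, (t <= T)%N ->
  opnorm (kappa^-1 *: Hblock A B gamma T t - 1%:M) <= delta.
Hypothesis Eblock_small : forall t, opnorm (Eblock A B t) <= kappa * theta.

Let kappa_gt0 : 0 < kappa. Proof. exact: lt_le_trans kappa_ge1. Qed.

Lemma theta_ge0 : 0 <= theta.
Proof.
by rewrite -(pmulr_rge0 _ kappa_gt0) (le_trans (opnorm_ge0 _) (Eblock_small 0)).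
Qed.

Lemma l2norm_pred_term (x : nat -> 'cV[R]_n) t :
  l2norm (pred_term x t) = pred_term (fun s => l2norm (x s)) t.
Proof. by case: t => //=; rewrite l2norm0. Qed.

Lemma subdiagonal_bound (x : nat -> 'cV[R]_n) t :
  l2norm ((A t)^T *m (B t *m pred_term x t))
  <= kappa * (theta * pred_term (fun s => l2norm (x s)) t).
Proof.
rewrite -l2norm_pred_term; case: t => [|t] /=.
  by rewrite !mulmx0 !l2norm0 !mulr0.
rewrite mulmxA mulrA; apply: le_trans (opnormP (Eblock A B t) _) _.
by rewrite ler_wpM2r ?l2norm_ge0.
Qed.

Lemma superdiagonal_bound (v : 'cV[R]_n) t :
  l2norm ((Eblock A B t)^T *m v) <= kappa * (theta * l2norm v).
Proof.
rewrite mulrA; apply: le_trans (opnorm_trP _ _) _.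
by rewrite ler_wpM2r ?l2norm_ge0.
Qed.

(** The Gram bound yields the factor [Num.sqrt kappa]; [1 <= kappa] weakens it to [kappa], the
    common factor that cancels in [minimizer_row]. *)
Lemma rhs_bound T t : has_ubound (y_pair_norms y) -> (t <= T)%N ->
  l2norm ((design_col A B T t)^T *m col_mx (y t) (y t.+1))
  <= kappa * (Num.sqrt (1 + delta) * sup (y_pair_norms y)).
Proof.
move=> yub tT; apply: le_trans (gram_adjoint_bound kappa_gt0 (Hblock_near tT)
  _ gamma_ge0 (Hblock_design _ _ _ _ _)) _.
rewrite mulrA ler_pM ?sqrtr_ge0 ?l2norm_ge0//.
  rewrite sqrtrM ?(ltW kappa_gt0)// ler_wpM2r ?sqrtr_ge0//.
  rewrite -{2}(sqr_sqrtr (ltW kappa_gt0)) expr2 ler_peMl ?sqrtr_ge0//.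
  by rewrite -[leLHS]sqrtr1 ler_wsqrtr.
by apply: ub_le_sup => //; exists t.
Qed.

Lemma minimizer_row T x t : has_ubound (y_pair_norms y) ->
  lsq_minimizer A B y gamma T x -> (t <= T)%N ->
  (1 - delta) * l2norm (x t)
  <= theta * pred_term (fun s => l2norm (x s)) t
     + theta * (if (t < T)%N then l2norm (x t.+1) else 0)
     + Num.sqrt (1 + delta) * sup (y_pair_norms y).
Proof.
move=> yub xmin tT; rewrite -(ler_pM2l kappa_gt0).
apply: le_trans (near_id_lower kappa_gt0 (Hblock_near tT) _) _.
rewrite (lsq_normal_equations xmin tT).
have g := rhs_bound yub tT; have e := subdiagonal_bound x t.
have : l2norm (if (t < T)%N then (Eblock A B t)^T *m x t.+1 else 0)
    <= kappa * (theta * (if (t < T)%N then l2norm (x t.+1) else 0)).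
  by case: ifP => _; [exact: superdiagonal_bound | rewrite l2norm0 !mulr0].
move: g e; set g := _ *m col_mx _ _; set e := _ *m (_ *m _).
set f := if _ then _ else _.
by have := l2normB (g - e) f; have := l2normB g e; lra.
Qed.

Lemma minimizer_diff_row T S x z t :
  lsq_minimizer A B y gamma T x -> lsq_minimizer A B y gamma S z ->
  (t < T)%N -> (T <= S)%N ->
  (1 - delta) * l2norm (z t - x t)
  <= theta * pred_term (fun s => l2norm (z s - x s)) t
     + theta * l2norm (z t.+1 - x t.+1).
Proof.
move=> xmin zmin tT TS; rewrite -(ler_pM2l kappa_gt0).
have tS : (t < S)%N := leq_trans tT TS.
apply: le_trans (near_id_lower kappa_gt0 (Hblock_near (ltnW tT)) _) _.
have -> : Hblock A B gamma T t *m (z t - x t) =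
  - ((A t)^T *m (B t *m pred_term (fun s => z s - x s) t))
  - (Eblock A B t)^T *m (z t.+1 - x t.+1).
  (* Row [t] lies strictly below both horizons, so the diagonal blocks agree and the data terms
     cancel on subtraction. *)
  have HTS : Hblock A B gamma T t = Hblock A B gamma S t.
    by rewrite /Hblock tT tS.
  rewrite mulmxBr (lsq_normal_equations xmin (ltnW tT)).
  rewrite HTS (lsq_normal_equations zmin (ltnW tS)) /design_col tT tS.
  have -> : pred_term (fun s => z s - x s) t = pred_term z t - pred_term x t.
    by case: (t) => //=; rewrite subr0.
  rewrite !mulmxBr; move: (_ *m col_mx _ _) (_ *m x _) (_ *m z _).
  move: (_ *m (_ *m _)) (_ *m (_ *m _)) => a b c d e.
  by apply/colP => i; rewrite !mxE; ring.
apply: le_trans (l2normB _ _) _; rewrite l2normN mulrDr.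
by rewrite lerD ?superdiagonal_bound ?subdiagonal_bound.
Qed.

End LeastSquaresEstimates.

(** * The root [1 - eps_star] and the convergence theorem *)

Lemma eps_star_quadratic (R : realType) (delta theta : R) :
  0 <= theta -> theta <= (1 - delta) / 2 ->
  (1 - eps_star delta theta) ^+ 2
  = (1 - delta) * (1 - eps_star delta theta) - theta ^+ 2.
Proof.
move=> theta0 thetale; rewrite /eps_star.
set D := (1 - delta) ^+ 2 / 4 - theta ^+ 2.
(* A nonnegative discriminant makes [Num.sqrt D] a true square root, so
   [(1 - delta) / 2 + Num.sqrt D] is a root of the quadratic. *)
have D0 : 0 <= D.
  have : theta ^+ 2 <= ((1 - delta) / 2) ^+ 2.
    by rewrite ler_pXn2r ?nnegrE// (le_trans theta0).
  rewrite /D; lra.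
have := sqr_sqrtr D0; set q := Num.sqrt D; rewrite {1}/D => qE.
have -> : theta ^+ 2 = (1 - delta) ^+ 2 / 4 - q ^+ 2 by rewrite qE /D; ring.
by field.
Qed.

(** Equality would make the discriminant vanish, so that [1 - eps_star delta theta] equals [theta],
    against the strict hypothesis. *)
Lemma twice_theta_lt (R : realType) (delta theta : R) :
  theta <= (1 - delta) / 2 -> 0 <= theta -> theta < 1 - eps_star delta theta ->
  2 * theta < 1 - delta.
Proof.
move=> thetale theta0 lt; rewrite lt_neqAle; apply/andP; split; last by lra.
apply/eqP => thetaE; move: lt; rewrite /eps_star -thetaE.
have -> : (2 * theta) ^+ 2 / 4 - theta ^+ 2 = 0 by field.
by rewrite sqrtr0; lra.
Qed.

Theorem theorem1 (R : realType) :
  exists C : R -> R -> R -> R,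
  forall (m n : nat) (A B : nat -> 'M[R]_(m, n)) (y : nat -> 'cV[R]_m)
         (gamma : R) (xhat : nat -> nat -> 'cV[R]_n)
         (kappa delta theta : R),
    0 <= gamma ->
    (forall T : nat, lsq_minimizer A B y gamma T (xhat T)) ->
    1 <= kappa ->
    delta < 1 ->
    theta <= (1 - delta) / 2 ->
    (forall T t : nat, (t <= T)%N ->
       opnorm (kappa^-1 *: Hblock A B gamma T t - 1%:M) <= delta) ->
    (forall t : nat, opnorm (Eblock A B t) <= kappa * theta) ->
    theta < 1 - eps_star delta theta ->
    has_ubound (y_pair_norms y) ->
    exists xstar : nat -> 'cV[R]_n,
      (forall t : nat, xhat T t @[T --> \oo] --> xstar t) /\
      (forall T t : nat, (t <= T)%N ->
         l2norm (xhat T t - xstar t)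
         <= C (eps_star delta theta) theta delta * sup (y_pair_norms y)
            * (theta / (1 - eps_star delta theta)) ^+ (T - t)).
Proof.
(* Twice the uniform bound on the minimizers, per unit of [sup (y_pair_norms y)]: block [T] of the
   difference of two minimizers is at most the sum of their norms. *)
exists (fun _ theta delta =>
  2 * (Num.sqrt (1 + delta) / (1 - delta - 2 * theta))).
move=> m n A B y gamma xhat kappa delta theta gamma0 xmin kappa1 delta1 thetale.
move=> Hnear Esmall thetalt yub.
have theta0 := theta_ge0 kappa1 Esmall.
have theta2 := twice_theta_lt thetale theta0 thetalt.
have sE := eps_star_quadratic theta0 thetale.
set s := 1 - eps_star delta theta in thetalt sE *.
have s0 : 0 < s := le_lt_trans theta0 thetalt.
set M := sup (y_pair_norms y).
have M0 : 0 <= M.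
  apply: le_trans (l2norm_ge0 (col_mx (y 0) (y 1))) (ub_le_sup yub _).
  by exists 0.
pose K := Num.sqrt (1 + delta) * M / (1 - delta - 2 * theta).
have xK T t : (t <= T)%N -> l2norm (xhat T t) <= K.
  move=> tT.
  apply: (@tridiagonal_bound _ (fun t => l2norm (xhat T t)) _ _ _ T) => //.
  - by rewrite mulr_ge0 ?sqrtr_ge0.
  - by move=> s'; exact: l2norm_ge0.
  - move=> s' s'T.
    exact: (minimizer_row gamma0 kappa1 Hnear Esmall yub (xmin T)).
pose e t T := 2 * K * (theta / s) ^+ (T - t).
have xdiff t T S : (t <= T)%N -> (T <= S)%N ->
    l2norm (xhat S t - xhat T t) <= e t T.
  move=> tT TS.
  apply: le_trans (@tridiagonal_decay _ (fun t => l2norm (xhat S t - xhat T t))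
    (1 - delta) s theta T s0 theta0 sE _ _ t tT) _.
  - by move=> s'; exact: l2norm_ge0.
  - move=> s' s'T.
    exact: (minimizer_diff_row kappa1 Hnear Esmall (xmin T) (xmin S)).
  rewrite /e mulrC ler_wpM2r ?exprn_ge0 ?divr_ge0 ?(ltW s0)//.
  apply: le_trans (l2normB _ _) _.
  by have := xK S T TS; have := xK T T (leqnn T); lra.
(* Shifting the index by [t] removes the truncated subtraction and leaves a geometric sequence of
   ratio [theta / s < 1]. *)
have e_cvg t : e t @ \oo --> 0.
  rewrite -(cvg_shiftn t) /e.
  under eq_fun => T do rewrite addnK.
  apply: cvg_geometric; rewrite ger0_norm ?divr_ge0 ?(ltW s0)//.
  by rewrite ltr_pdivrMr// mul1r.
have /choice[xstar xstarP] t := l2norm_cauchy_limit (e_cvg t) (xdiff t).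
exists xstar; split=> [t|T t tT]; first by have [] := xstarP t.
have [_ /(_ T tT) h] := xstarP t; apply: le_trans h _.
by rewrite /e /K (mulrAC _ M) !mulrA.
Qed.
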